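(* Let $\nu_1,\nu_2\ge 0$ and let $\mathcal{L}_n^{(\nu_1,\nu_2)}$ ($n\ge1$) be the Stancu type operators including generalized Brenke polynomials associated with $A_1,A_2,h$ as in the context. There is a positive constant $C$ (independent of $f$, $n$ and $x$) such that for every $f\in C_B[0,\infty)$, every $n\ge1$ and every $x\in[0,\infty)$, $$\left|\mathcal{L}_n^{(\nu_1,\nu_2)}(f;x)-f(x)\right|\le C\,\omega_2\left(f;\sqrt{\mu_n(x)}\right)+\omega\left(f;\left|\mathcal{L}_n^{(\nu_1,\nu_2)}(s-x;x)\right|\right),$$ where $$\mu_n(x)=\frac18\left\{\mathcal{L}_n^{(\nu_1,\nu_2)}\left((s-x)^2;x\right)+\left[\mathcal{L}_n^{(\nu_1,\nu_2)}(s-x;x)\right]^2\right\},$$ $\omega(f;\cdot)$ is the modulus of continuity and $\omega_2(f;\cdot)$ is the second order modulus of smoothness of $f$.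
   Context: Setting. Let $R>1$. Let $A_1,A_2:\mathbb{R}\to(0,\infty)$ and $h$ be functions, analytic on $\{t:|t|<R\}$ with (real) power series expansions convergent for $|t|<R$: $A_1(t)=\sum_{k\ge0}a_{1,k}t^k$ with $a_{1,0}\neq0$; $A_2(t)=\sum_{k\ge0}a_{2,k}t^k$ with $a_{2,k}\ne0$ for all $k$; $h(t)=\sum_{k\ge1}h_kt^k$ with $h_1\neq0$. The generalized Brenke polynomials $\pi_k$ ($k\ge 0$) are the polynomials with $$A_1(h(t))\,A_2(xh(t))=\sum_{k=0}^\infty \pi_k(x)t^k ,$$ where the series converges and the identity holds for real $t$ with $|t|<R$ and every $x\in[0,\infty)$. It is assumed that $h'(1)=1$ and $\pi_k(x)\ge0$ for all $k\ge0$ and $x\in[0,\infty)$. Operators. For $\nu_1,\nu_2\ge0$, $n\ge1$, $x\in[0,\infty)$ and $f:[0,\infty)\to\mathbb{R}$ (for which the series converges), $$\mathcal{L}_n^{(\nu_1,\nu_2)}(f;x)=\frac{1}{A_1(h(1))A_2(nxh(1))}\sum_{k=0}^\infty\pi_k(nx)\,f\!\left(\frac{k+\nu_1}{n+\nu_2}\right).$$ In $\mathcal{L}_n^{(\nu_1,\nu_2)}(s-x;x)$ and $\mathcal{L}_n^{(\nu_1,\nu_2)}((s-x)^2;x)$ the operator acts on functions of $s$, with $x$ fixed. $C_B[0,\infty)$ is the space of bounded continuous real functions on $[0,\infty)$. For $\delta\ge0$: $\omega(f;\delta)=\sup\{|f(s)-f(t)|:s,t\in[0,\infty),\ |s-t|\le\delta\}$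 and $\omega_2(f;\delta)=\sup_{0\le u\le\delta}\ \sup_{x\in[0,\infty)}|f(x+2u)-2f(x+u)+f(x)|$. *)

(* Defs.v *)
From Stdlib Require Import Reals.
From Coquelicot Require Import Coquelicot.
Open Scope R_scope.

Definition polynomial_fun (p : R -> R) : Prop :=
  exists (d : nat) (c : nat -> R), forall x, p x = sum_f_R0 (fun i => c i * x ^ i) d.

(* [r] is the common radius of validity (the letter R being taken by the type
   of reals).  [A1], [A2], [h] are total real functions, whose expansions are
   only required on ]-r, r[; outside, [A1] and [A2] are merely positive.
   [a1], [a2], [c] are the Taylor coefficients of [A1], [A2], [h]. *)
Record generalized_brenke (r : R) (A1 A2 h : R -> R) (a1 a2 c : nat -> R)
    (p : nat -> R -> R) : Prop := {
  brenke_radius : 1 < r;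
  brenke_A1_pos : forall t, 0 < A1 t;
  brenke_A2_pos : forall t, 0 < A2 t;
  brenke_A1_series : forall t, Rabs t < r -> is_pseries a1 t (A1 t);
  brenke_A2_series : forall t, Rabs t < r -> is_pseries a2 t (A2 t);
  brenke_h_series : forall t, Rabs t < r -> is_pseries c t (h t);
  brenke_a1_0 : a1 0%nat <> 0;
  brenke_a2_neq0 : forall k, a2 k <> 0;
  brenke_h_0 : c 0%nat = 0;
  brenke_h_1 : c 1%nat <> 0;
  brenke_poly : forall k, polynomial_fun (p k);
  brenke_generating : forall t x, Rabs t < r -> 0 <= x ->
    is_pseries (fun k => p k x) t (A1 (h t) * A2 (x * h t))
}.

(* Functions on [0, +oo[ are represented by total functions, of which only the
   values on [0, +oo[ are used.  [Series] is a total operator: it is the sum of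
   the series whenever that series converges.  In the setting of
   [generalized_brenke] with nonnegative [p k], it does converge when [f] is
   bounded on [0, +oo[ or a polynomial, because 1 < r. *)
Definition stancu_op (A1 A2 h : R -> R) (p : nat -> R -> R) (nu1 nu2 : R)
    (n : nat) (f : R -> R) (x : R) : R :=
  / (A1 (h 1) * A2 (INR n * x * h 1)) *
  Series (fun k => p k (INR n * x) * f ((INR k + nu1) / (INR n + nu2))).

Definition bounded_continuous (f : R -> R) : Prop :=
  continuous_on (fun x => 0 <= x) f /\
  exists M, forall x, 0 <= x -> Rabs (f x) <= M.

(* The suprema below are finite when [f] is bounded on [0, +oo[ and the step
   is nonnegative, so that the projection [real] of [Rbar] is harmless. *)
Definition omega (f : R -> R) (delta : R) : R :=
  real (Lub_Rbar (fun y => exists s t, 0 <= s /\ 0 <= t /\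
                    Rabs (s - t) <= delta /\ y = Rabs (f s - f t))).

Definition omega2 (f : R -> R) (delta : R) : R :=
  real (Lub_Rbar (fun y => exists u, 0 <= u <= delta /\
    y = real (Lub_Rbar (fun z => exists x, 0 <= x /\
          z = Rabs (f (x + 2 * u) - 2 * f (x + u) + f x))))).

Definition stancu_mu (A1 A2 h : R -> R) (p : nat -> R -> R) (nu1 nu2 : R)
    (n : nat) (x : R) : R :=
  / 8 * (stancu_op A1 A2 h p nu1 nu2 n (fun s => (s - x) ^ 2) x +
         (stancu_op A1 A2 h p nu1 nu2 n (fun s => s - x) x) ^ 2).

(* Main.v *)
Require Import Defs.
From Stdlib Require Import Reals Lra.
From Coquelicot Require Import Coquelicot.
Open Scope R_scope.

(* The operator is an expectation E f(S) for a probability law carried by the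
   nodes (k + nu1) / (n + nu2).  With m = E S, the difference f(m) - f(x) is at
   most omega(f; |m - x|).  If W = omega2(f; d), then f stays within
   W (11 + 5 (y - m)^2 / d^2) of the chord through the abscissae m and m + d: on
   [m, m + d] a bounded function whose second differences are at most W and
   which vanishes at both ends is itself at most W, and outside the bound is
   propagated by steps of length d, since the first difference of step d changes
   by at most W per step.  Taking expectations removes the linear part, and
   Var S <= 8 d^2 for d = sqrt (mu_n x). *)

(** * The moduli as finite suprema *)

(** The element [y] excludes [m_infty] and the bound [B] excludes [p_infty], so [real] returns the
    true supremum. *)
Lemma Lub_Rbar_real_bounds (E : R -> Prop) (B y : R) :
  (forall z, E z -> z <= B) -> E y -> y <= real (Lub_Rbar E) <= B.
Proof.
  intros HB Hy.
  destruct (Lub_Rbar_correct E) as [Hub Hlub].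
  assert (H1 : Rbar_le y (Lub_Rbar E)) by (apply Hub; exact Hy).
  assert (H2 : Rbar_le (Lub_Rbar E) B) by (apply Hlub; intros z Hz; apply HB, Hz).
  destruct (Lub_Rbar E); simpl in *; tauto || lra.
Qed.

Lemma omega_ge (f : R -> R) (M d s t : R) :
  (forall x, 0 <= x -> Rabs (f x) <= M) ->
  0 <= s -> 0 <= t -> Rabs (s - t) <= d -> Rabs (f s - f t) <= omega f d.
Proof.
  intros HM Hs Ht Hd.
  refine (proj1 (Lub_Rbar_real_bounds _ (2 * M) _ _ _)).
  - intros z (s' & t' & Hs' & Ht' & _ & ->).
    generalize (HM _ Hs') (HM _ Ht'); split_Rabs; lra.
  - now exists s, t.
Qed.

(** Both nested suprema are at most [4 * M], hence finite: first over the points at a fixed step,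
    then over the steps. *)
Lemma omega2_ge (f : R -> R) (M d u x : R) :
  (forall x, 0 <= x -> Rabs (f x) <= M) -> 0 <= u <= d -> 0 <= x ->
  Rabs (f (x + 2 * u) - 2 * f (x + u) + f x) <= omega2 f d.
Proof.
  intros HM Hu Hx.
  assert (Hin : forall v y, 0 <= v -> 0 <= y ->
    Rabs (f (y + 2 * v) - 2 * f (y + v) + f y) <=
    real (Lub_Rbar (fun z => exists x, 0 <= x /\
          z = Rabs (f (x + 2 * v) - 2 * f (x + v) + f x))) <= 4 * M).
  { intros v y Hv Hy. apply Lub_Rbar_real_bounds.
    - intros z (x' & Hx' & ->).
      assert (H2 : 0 <= x' + 2 * v) by lra.
      assert (H1 : 0 <= x' + v) by lra.
      generalize (HM _ H2) (HM _ H1) (HM _ Hx'); split_Rabs; lra.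
    - now exists y. }
  eapply Rle_trans; [apply Hin; lra |].
  refine (proj1 (Lub_Rbar_real_bounds _ (4 * M) _ _ _)).
  - intros z (v & Hv & ->). apply (Hin v 0); lra.
  - now exists u.
Qed.

Lemma omega2_nonneg (f : R -> R) (M d : R) :
  (forall x, 0 <= x -> Rabs (f x) <= M) -> 0 <= d -> 0 <= omega2 f d.
Proof.
  intros HM Hd.
  eapply Rle_trans; [apply Rabs_pos |].
  apply (omega2_ge f M d d 0); trivial; lra.
Qed.

(** * Distance to a chord *)

(** Let [S] be the supremum of [Rabs (g y)], finite thanks to [K]. The second difference centred at
    [t] and reaching the nearer endpoint, where [g] vanishes, has its other end in the interval, so
    twice [Rabs (g t)] is at most [S + W]. Hence [S <= (S + W) / 2], that is [S <= W]. *)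
Lemma second_difference_bound (g : R -> R) (K W a b : R) :
  (forall y, a <= y <= b -> Rabs (g y) <= K) ->
  (forall y u, a <= y -> 0 <= u -> y + 2 * u <= b ->
     Rabs (g (y + 2 * u) - 2 * g (y + u) + g y) <= W) ->
  g a = 0 -> g b = 0 ->
  forall y, a <= y <= b -> Rabs (g y) <= W.
Proof.
  intros HK HW Ha Hb y Hy.
  destruct (completeness (fun z => exists y, a <= y <= b /\ z = Rabs (g y)))
    as [S [Sub Slub]].
  { exists K. intros z (t & Ht & ->). now apply HK. }
  { exists (Rabs (g y)), y. now split. }
  assert (HS : forall t, a <= t <= b -> Rabs (g t) <= S).
  { intros t Ht. apply Sub. now exists t. }
  assert (Hmid : forall t, a <= t <= b -> Rabs (g t) <= (S + W) / 2).
  { intros t Ht. destruct (Rle_lt_dec (2 * t) (a + b)) as [Hl | Hl].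
    - generalize (HW a (t - a) ltac:(lra) ltac:(lra) ltac:(lra)).
      generalize (HS (a + 2 * (t - a)) ltac:(lra)).
      replace (a + (t - a)) with t by ring. rewrite Ha. split_Rabs; lra.
    - generalize (HW (2 * t - b) (b - t) ltac:(lra) ltac:(lra) ltac:(lra)).
      generalize (HS (2 * t - b) ltac:(lra)).
      replace (2 * t - b + 2 * (b - t)) with b by ring.
      replace (2 * t - b + (b - t)) with t by ring.
      rewrite Hb. split_Rabs; lra. }
  assert (S <= (S + W) / 2).
  { apply Slub. intros z (t & Ht & ->). now apply Hmid. }
  generalize (HS y Hy). lra.
Qed.

Lemma quadratic_growth (g : R -> R) (W m d : R) :
  0 <= m -> 0 < d -> 0 <= W ->
  (forall y u, 0 <= y -> 0 <= u <= d ->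
     Rabs (g (y + 2 * u) - 2 * g (y + u) + g y) <= W) ->
  (forall y, m <= y <= m + d -> Rabs (g y) <= W) -> g m = 0 ->
  forall j y, 0 <= y -> m - INR j * d <= y <= m + (INR j + 1) * d ->
    Rabs (g (y + d) - g y) <= (4 + INR j) * W /\
    Rabs (g y) <= (1 + 5 * INR j + INR j ^ 2) * W.
Proof.
  intros Hm Hd HW0 HW Hbase Hgm.
  induction j as [| j IH]; intros y Hy Hyj.
  - simpl INR in *.
    assert (Hyb : m <= y <= m + d) by lra.
    (* The second difference from [m] to [y + d] has its midpoint in the base interval, so
       [Rabs (g (y + d)) <= 3 * W]; subtracting [g y] gives the constant 4. *)
    generalize (HW m ((y + d - m) / 2) ltac:(lra) ltac:(lra)).
    generalize (Hbase (m + (y + d - m) / 2) ltac:(lra)) (Hbase y Hyb).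
    replace (m + 2 * ((y + d - m) / 2)) with (y + d) by field.
    rewrite Hgm. split_Rabs; split; lra.
  - rewrite S_INR in *.
    pose proof (pos_INR j) as Hj.
    assert (HjW : 0 <= INR j * W) by (apply Rmult_le_pos; lra).
    destruct (Rle_lt_dec y (m + (INR j + 1) * d)) as [Hr | Hr].
    + destruct (Rle_lt_dec (m - INR j * d) y) as [Hl | Hl].
      * destruct (IH y Hy (conj Hl Hr)) as [I1 I2]. split; nra.
      * assert (0 <= INR j * d) by (apply Rmult_le_pos; lra).
        destruct (IH (y + d) ltac:(lra) ltac:(lra)) as [I1 I2].
        generalize (HW y d Hy ltac:(lra)).
        replace (y + 2 * d) with (y + d + d) by ring.
        intros I3.
        assert (I4 : Rabs (g (y + d) - g y) <= (5 + INR j) * W).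
        { clear I2. split_Rabs; lra. }
        split; [lra |].
        (* From [j] to [j + 1] the quadratic coefficient grows by [6 + 2 * INR j], which covers this
           first difference. *)
        assert (Rabs (g y) <= (1 + 5 * INR j + INR j ^ 2) * W + (5 + INR j) * W).
        { clear I1 I3. split_Rabs; lra. }
        nra.
    + assert (0 <= INR j * d) by (apply Rmult_le_pos; lra).
      destruct (IH (y - d) ltac:(lra) ltac:(lra)) as [I1 I2].
      generalize (HW (y - d) d ltac:(lra) ltac:(lra)).
      replace (y - d + 2 * d) with (y + d) by ring.
      replace (y - d + d) with y in * by ring.
      intros I3.
      split; [clear I2; split_Rabs; lra |].
      assert (Rabs (g y) <= (1 + 5 * INR j + INR j ^ 2) * W + (4 + INR j) * W).
      { clear I3. split_Rabs; lra. }
      nra.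
Qed.

(** The slope [a] is that of the chord over [m] and [m + d]. Subtracting an affine function leaves
    second differences unchanged, so both preceding lemmas apply to the remainder [g]. *)
Lemma omega2_chord (f : R -> R) (M m d : R) :
  (forall x, 0 <= x -> Rabs (f x) <= M) -> 0 <= m -> 0 < d ->
  exists a, forall y, 0 <= y ->
    Rabs (f y - f m - a * (y - m)) <= (11 + 5 * ((y - m) ^ 2 / d ^ 2)) * omega2 f d.
Proof.
  intros HM Hm Hd.
  pose proof (omega2_nonneg f M d HM (Rlt_le _ _ Hd)) as HW0.
  set (W := omega2 f d) in *.
  set (a := (f (m + d) - f m) / d).
  exists a.
  set (g := fun y => f y - f m - a * (y - m)).
  assert (HW : forall y u, 0 <= y -> 0 <= u <= d ->
     Rabs (g (y + 2 * u) - 2 * g (y + u) + g y) <= W).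
  { intros y u Hy Hu. unfold g.
    replace (_ - _ + _) with (f (y + 2 * u) - 2 * f (y + u) + f y) by ring.
    now apply omega2_ge with M. }
  assert (Hgm : g m = 0) by (unfold g; ring).
  assert (Hgd : g (m + d) = 0) by (unfold g, a; field; lra).
  assert (Hbase : forall y, m <= y <= m + d -> Rabs (g y) <= W).
  { apply second_difference_bound with (K := 2 * M + Rabs a * d); trivial.
    - intros y Hy. unfold g.
      assert (Ha : Rabs (a * (y - m)) <= Rabs a * d).
      { rewrite Rabs_mult. apply Rmult_le_compat_l; [apply Rabs_pos |].
        split_Rabs; lra. }
      assert (Hy0 : 0 <= y) by lra.
      generalize (HM _ Hy0) (HM _ Hm) Ha. generalize (a * (y - m)) (Rabs a * d).
      intros; split_Rabs; lra.
    - intros y u Hy Hu Hb. apply HW; lra. }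
  intros y Hy. fold (g y).
  set (z := Rabs (y - m) / d).
  assert (Hz0 : 0 <= z) by (apply Rdiv_le_0_compat; [apply Rabs_pos | lra]).
  assert (Hz : Rabs (y - m) = z * d) by (unfold z; field; lra).
  replace ((y - m) ^ 2 / d ^ 2) with (z ^ 2).
  2:{ unfold z. rewrite <- (pow2_abs (y - m)). field; lra. }
  (* The index [S j] is what reaches [y] when it lies left of [m], at distance less than
     [(INR j + 1) * d]. *)
  destruct (nfloor_ex z Hz0) as [j Hj].
  destruct (quadratic_growth g W m d Hm Hd HW0 HW Hbase Hgm (S j) y Hy) as [_ HB].
  { rewrite S_INR.
    assert (z * d <= (INR j + 1) * d) by (apply Rmult_le_compat_r; lra).
    split_Rabs; lra. }
  eapply Rle_trans; [exact HB |].
  apply Rmult_le_compat_r; trivial.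
  rewrite S_INR.
  assert (INR j ^ 2 <= z ^ 2) by (apply pow_incr; split; [apply pos_INR | lra]).
  (* The coefficient is at most [7 + 7 * z + z ^ 2], and [4 * z ^ 2 - 7 * z + 4] is positive by
     completing the square. *)
  generalize (pow2_ge_0 (z - 7 / 8)). lra.
Qed.

(** * Expectations as weighted series *)

Lemma is_series_Rabs_le (a b : nat -> R) (la lb : R) :
  (forall k, Rabs (a k) <= b k) -> is_series a la -> is_series b lb ->
  Rabs la <= lb.
Proof.
  intros Hab Ha Hb.
  assert (ex_series (fun k => Rabs (a k))).
  { apply (ex_series_le (K := R_AbsRing) (V := R_CompleteNormedModule) _ b).
    - intros k. change (Rabs (Rabs (a k)) <= b k). now rewrite Rabs_Rabsolu.
    - now exists lb. }
  rewrite <- (is_series_unique _ _ Ha), <- (is_series_unique _ _ Hb).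
  eapply Rle_trans; [now apply Series_Rabs |].
  apply Series_le; [| now exists lb].
  intros k. split; [apply Rabs_pos | apply Hab].
Qed.

Lemma is_series_comb3 (a b c : nat -> R) (la lb lc u v w : R) :
  is_series a la -> is_series b lb -> is_series c lc ->
  is_series (fun k => u * a k + v * b k + w * c k) (u * la + v * lb + w * lc).
Proof.
  intros Ha Hb Hc.
  repeat apply (is_series_plus (V := R_NormedModule));
    now apply (is_series_scal (K := R_AbsRing) (V := R_NormedModule)).
Qed.

(** The partial sums are nonnegative and increase to 0, so they all vanish. This serves the case of
    zero variance. *)
Lemma is_series_nonneg_0 (a : nat -> R) :
  (forall k, 0 <= a k) -> is_series a 0 -> forall k, a k = 0.
Proof.
  intros Ha H0 k.
  assert (Hsum : forall n, 0 <= sum_n a n <= 0).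
  { intros n. split.
    - induction n as [| n IH]; [rewrite sum_O; apply Ha |].
      rewrite sum_Sn. apply Rplus_le_le_0_compat; trivial.
    - apply (is_lim_seq_incr_compare (sum_n a) 0 H0).
      intros i. rewrite sum_Sn. change (sum_n a i <= sum_n a i + a (S i)).
      generalize (Ha (S i)). lra. }
  destruct k as [| k]; [rewrite <- (sum_O a); generalize (Hsum 0%nat); lra |].
  pose proof (Hsum (S k)) as HS. rewrite sum_Sn in HS.
  change (0 <= sum_n a k + a (S k) <= 0) in HS.
  generalize (Hsum k) (Ha (S k)). lra.
Qed.

(** Here [b] is the bias and [q] the mean square deviation from [x], so the mean is [x + b] and the
    variance [q - b ^ 2]. The latter is at most [q + b ^ 2], which is 8 times the squared step,
    whence [51 = 11 + 5 * 8]. *)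
Lemma expectation_approximation (w s : nat -> R) (f : R -> R) (M x b q : R) :
  (forall x, 0 <= x -> Rabs (f x) <= M) -> 0 <= x ->
  (forall k, 0 <= w k) -> (forall k, 0 <= s k) ->
  is_series w 1 -> is_series (fun k => w k * (s k - x)) b ->
  is_series (fun k => w k * (s k - x) ^ 2) q ->
  Rabs (Series (fun k => w k * f (s k)) - f x) <=
    51 * omega2 f (sqrt (/ 8 * (q + b ^ 2))) + omega f (Rabs b).
Proof.
  intros HM Hx Hw Hs H1 Hb Hq.
  assert (Hf : is_series (fun k => w k * f (s k)) (Series (fun k => w k * f (s k)))).
  { apply Series_correct.
    apply (ex_series_le (K := R_AbsRing) (V := R_CompleteNormedModule) _
             (fun k => M * w k)).
    - intros k. change (Rabs (w k * f (s k)) <= M * w k).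
      rewrite Rabs_mult, (Rabs_pos_eq (w k)) by trivial.
      rewrite Rmult_comm. apply Rmult_le_compat_r; auto.
    - exists (M * 1).
      now apply (is_series_scal (K := R_AbsRing) (V := R_NormedModule)). }
  set (F := Series _) in *.
  set (m := x + b).
  assert (Hmean : is_series (fun k => w k * s k) m).
  { pose proof (is_series_comb3 _ _ _ _ _ _ x 1 0 H1 Hb Hq) as H.
    replace m with (x * 1 + 1 * b + 0 * q) by (unfold m; ring).
    revert H. apply is_series_ext. intros k. simpl. ring. }
  assert (Hm : 0 <= m).
  { eapply Rle_trans; [apply Rabs_pos |].
    (* A nonnegative series compared with itself gives [Rabs m <= m]. *)
    refine (is_series_Rabs_le _ _ _ _ _ Hmean Hmean).
    intros k. apply Req_le, Rabs_pos_eq, Rmult_le_pos; trivial. }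
  assert (HV : is_series (fun k => w k * (s k - m) ^ 2) (q - b ^ 2)).
  { pose proof (is_series_comb3 _ _ _ _ _ _ (b ^ 2) (- 2 * b) 1 H1 Hb Hq) as H.
    replace (q - b ^ 2) with (b ^ 2 * 1 + - 2 * b * b + 1 * q) by ring.
    revert H. apply is_series_ext. intros k. unfold m. simpl. ring. }
  assert (HV0 : 0 <= q - b ^ 2).
  { eapply Rle_trans; [apply Rabs_pos |].
    refine (is_series_Rabs_le _ _ _ _ _ HV HV).
    intros k. apply Req_le, Rabs_pos_eq, Rmult_le_pos; trivial. apply pow2_ge_0. }
  assert (Hshift : Rabs (f m - f x) <= omega f (Rabs b)).
  { apply omega_ge with M; trivial. unfold m. right. f_equal. ring. }
  set (d := sqrt _).
  assert (Hmu : 0 <= / 8 * (q + b ^ 2)) by nra.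
  assert (Hd0 : 0 <= d) by apply sqrt_pos.
  assert (Hd2 : d ^ 2 = / 8 * (q + b ^ 2)) by now apply pow2_sqrt.
  enough (Rabs (F - f m) <= 51 * omega2 f d) by (split_Rabs; lra).
  pose proof (omega2_nonneg f M d HM Hd0) as HW0.
  destruct (Rle_lt_or_eq_dec _ _ Hd0) as [Hd | Hd].
  - destruct (omega2_chord f M m d HM Hm Hd) as [a Ha].
    apply Rle_trans with
      (11 * omega2 f d * 1 + 5 * omega2 f d / d ^ 2 * (q - b ^ 2) + 0 * b).
    + refine (is_series_Rabs_le (fun k => w k * (f (s k) - f m - a * (s k - m))) _
                _ _ _ _ (is_series_comb3 _ _ _ _ _ _ _ _ _ H1 HV Hb)).
      * intros k. rewrite Rabs_mult, (Rabs_pos_eq (w k)) by trivial.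
        replace (_ + _ + _) with
          (w k * ((11 + 5 * ((s k - m) ^ 2 / d ^ 2)) * omega2 f d)) by (field; lra).
        apply Rmult_le_compat_l; auto.
      (* As [s k - m = (s k - x) - b], the linear part has expectation [a * b - a * b = 0]. *)
      * pose proof (is_series_comb3 _ _ _ _ _ _ 1 (a * b - f m) (- a) Hf H1 Hb) as H.
        replace (F - f m) with (1 * F + (a * b - f m) * 1 + - a * b) by ring.
        revert H. apply is_series_ext. intros k. unfold m. simpl. ring.
    + assert (HVd : (q - b ^ 2) / d ^ 2 <= 8).
      { apply Rle_div_l; [nra |]. rewrite Hd2. nra. }
      replace (5 * omega2 f d / d ^ 2 * (q - b ^ 2))
        with (5 * omega2 f d * ((q - b ^ 2) / d ^ 2)) by (field; lra).
      nra.
  (* When [d = 0] the variance vanishes, so every node of nonzero weight equals [m] and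
     [F = f m]. *)
  - assert (HV1 : q - b ^ 2 = 0) by (rewrite <- Hd in Hd2; nra).
    rewrite HV1 in HV.
    assert (F = f m * 1) as ->.
    { eapply eq_trans; [| apply is_series_unique;
        apply (is_series_scal (K := R_AbsRing) (V := R_NormedModule) (f m) _ _ H1)].
      apply Series_ext. intros k.
      assert (H0 : w k * (s k - m) ^ 2 = 0).
      { refine (is_series_nonneg_0 _ _ HV k).
        intros i. apply Rmult_le_pos; trivial. apply pow2_ge_0. }
      change (w k * f (s k) = f m * w k).
      destruct (Rmult_integral _ _ H0) as [-> | H2]; [ring |].
      replace (s k) with m; [ring |].
      generalize (Rsqr_0_uniq (s k - m)). unfold Rsqr. nra. }
    rewrite Rmult_1_r, Rminus_diag, Rabs_R0. lra.
Qed.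

(** * Moments from the generating function *)

(** The radius of convergence exceeds 1, and multiplying the coefficients by [INR k] amounts to
    differentiating and then multiplying by the variable, which preserves the radius. *)
Lemma ex_series_moments (a : nat -> R) (r : R) :
  1 < r -> (forall t, Rabs t < r -> ex_pseries a t) ->
  ex_series (fun k => INR k * a k) /\ ex_series (fun k => INR k ^ 2 * a k).
Proof.
  intros Hr Ha.
  assert (Hcv : Rbar_lt 1 (CV_radius a)).
  (* At [(1 + r) / 2], strictly between 1 and [r], the series converges, so its terms tend to 0 and
     the point is not outside the disk. *)
  { apply Rbar_lt_le_trans with ((1 + r) / 2); [simpl; lra |].
    apply Rbar_not_lt_le. intros Hlt.
    apply (CV_disk_outside a ((1 + r) / 2)).
    - now rewrite Rabs_pos_eq by lra.
    - apply ex_series_lim_0.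
      apply ex_series_ext
        with (2 := Ha ((1 + r) / 2) ltac:(rewrite Rabs_pos_eq; lra)).
      intros k. rewrite pow_n_pow. apply Rmult_comm. }
  assert (Hin : forall b, Rbar_lt 1 (CV_radius b) -> ex_series b).
  { intros b Hb.
    apply ex_series_ext with (fun k => b k * 1 ^ k).
    - intros k. rewrite pow1. apply Rmult_1_r.
    - apply ex_series_Rabs, CV_disk_inside. now rewrite Rabs_R1. }
  assert (Hder : forall b, Rbar_lt 1 (CV_radius b) ->
    Rbar_lt 1 (CV_radius (fun k => INR k * b k))).
  { intros b Hb.
    rewrite <- CV_radius_derive in Hb. rewrite <- CV_radius_incr_1 in Hb.
    erewrite CV_radius_ext; [exact Hb |].
    intros [| k]; [apply Rmult_0_l | reflexivity]. }
  split; apply Hin.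
  - now apply Hder.
  - erewrite CV_radius_ext; [apply Hder, Hder, Hcv |].
    intros k. simpl. ring.
Qed.

Theorem theorem2p5 (r : R) (A1 A2 h : R -> R) (a1 a2 c : nat -> R)
    (p : nat -> R -> R)
    (Hbrenke : generalized_brenke r A1 A2 h a1 a2 c p)
    (Hh' : is_derive h 1 1)
    (Hp : forall k x, 0 <= x -> 0 <= p k x)
    (nu1 nu2 : R) (Hnu1 : 0 <= nu1) (Hnu2 : 0 <= nu2) :
  exists C : R, 0 < C /\
    forall (f : R -> R), bounded_continuous f ->
    forall (n : nat), (1 <= n)%nat ->
    forall (x : R), 0 <= x ->
      Rabs (stancu_op A1 A2 h p nu1 nu2 n f x - f x) <=
        C * omega2 f (sqrt (stancu_mu A1 A2 h p nu1 nu2 n x)) +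
        omega f (Rabs (stancu_op A1 A2 h p nu1 nu2 n (fun s => s - x) x)).
Proof.
  exists 51. split; [lra |].
  intros f [_ [M HM]] n Hn x Hx.
  assert (Hn1 : 1 <= INR n) by (apply (le_INR 1); exact Hn).
  assert (Hnx : 0 <= INR n * x) by (apply Rmult_le_pos; lra).
  set (N := A1 (h 1) * A2 (INR n * x * h 1)).
  assert (HN : 0 < N) by (apply Rmult_lt_0_compat; apply Hbrenke).
  set (pi := fun k => p k (INR n * x)).
  assert (Hgen : forall t, Rabs t < r ->
    is_pseries pi t (A1 (h t) * A2 (INR n * x * h t))).
  { intros t Ht. now apply (brenke_generating _ _ _ _ _ _ _ _ Hbrenke). }
  assert (Hr1 : 1 < r) by apply Hbrenke.
  assert (Hsum : is_series pi N).
  (* The generating identity at [t = 1] normalizes the weights. *)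
  { pose proof (proj1 (is_pseries_R _ _ _)
      (Hgen 1 ltac:(now rewrite Rabs_R1))) as H.
    revert H. apply is_series_ext. intros k. cbv beta. rewrite pow1. apply Rmult_1_r. }
  destruct (ex_series_moments pi r Hr1) as [[S1 HS1] [S2 HS2]].
  { intros t Ht. eexists. now apply Hgen. }
  set (w := fun k => / N * pi k).
  set (s := fun k => (INR k + nu1) / (INR n + nu2)).
  assert (Hop : forall g, stancu_op A1 A2 h p nu1 nu2 n g x =
                          Series (fun k => w k * g (s k))).
  { intros g. unfold stancu_op. rewrite <- Series_scal_l. apply Series_ext.
    intros k. unfold w, pi, s, N. ring. }
  assert (Hw : forall k, 0 <= w k).
  { intros k. apply Rmult_le_pos; [| now apply Hp].
    apply Rlt_le, Rinv_0_lt_compat, HN. }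
  assert (Hs : forall k, 0 <= s k).
  { intros k. apply Rdiv_le_0_compat; [| lra]. generalize (pos_INR k); lra. }
  assert (Hw1 : is_series w 1).
  { replace 1 with (/ N * N) by (field; lra).
    now apply (is_series_scal (K := R_AbsRing) (V := R_NormedModule)). }
  assert (Hmom : forall u v z,
    ex_series (fun k => w k * (u + v * INR k + z * INR k ^ 2))).
  { intros u v z. eexists.
    eapply is_series_ext;
      [| exact (is_series_comb3 _ _ _ _ _ _ (/ N * u) (/ N * v) (/ N * z) Hsum HS1 HS2)].
    intros k. unfold w. simpl. ring. }
  set (D := INR n + nu2).
  assert (HD : D <> 0) by (unfold D; lra).
  unfold stancu_mu. rewrite !Hop.
  (* With [b] and [q] equal to the [Series] themselves, convergence remains; [s k - x] and its
     square are polynomials in [INR k] of degree at most 2, covered by [Hmom]. *)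
  apply expectation_approximation with M; trivial; apply Series_correct.
  - eapply ex_series_ext; [| exact (Hmom (nu1 / D - x) (/ D) 0)].
    intros k. unfold s. fold D. simpl. field. exact HD.
  - eapply ex_series_ext;
      [| exact (Hmom ((nu1 / D - x) ^ 2) (2 * (nu1 / D - x) / D) (/ D ^ 2))].
    intros k. unfold s. fold D. simpl. field. exact HD.
Qed.
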